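(* Let $n>3$ and let $f:\{0,1\}^n\to\{0,1\}$ be a Boolean function. Then $Q_E(f)=n$ if and only if $f$ is isomorphic to $\mathrm{AND}_n$.
   Context: $\mathrm{AND}_n(x)=1$ iff all $n$ input bits are $1$. Two Boolean functions $f,g$ on $n$ bits are isomorphic if $g$ can be obtained from $f$ by permuting the input variables, negating some of the input variables, and possibly negating the output. $Q_E(f)$ (exact quantum query complexity) is the minimum number $t$ of queries in an exact quantum query algorithm for $f$: such an algorithm works in a finite-dimensional Hilbert space with a fixed orthonormal basis, starts in a fixed state, applies $U_1,Q,U_2,Q,\dots,U_t,Q,U_{t+1}$ where the $U_j$ are unitaries independent of the input $x$ and $Q$ is the query operator (each basis state is associated with at most one index $i\in[n]$; $Q$ multiplies a basis state associated with $i$ by $(-1)^{x_i}$ and leaves basis states associated with no index unchanged), then measures in the basis and outputs a bit depending on the outcome; the output must equal $f(x)$ with probability $1$ for every $x\in\{0,1\}^n$. *)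

(* Defs.v *)
From HB Require Import structures.
From mathcomp Require Import all_boot all_order all_algebra all_fingroup.
From mathcomp Require Import reals complex.

Set Implicit Arguments.
Unset Strict Implicit.
Unset Printing Implicit Defensive.

Import GRing.Theory Num.Theory.
Local Open Scope ring_scope.
Local Open Scope complex_scope.

Definition bits (n : nat) := {ffun 'I_n -> bool}.

Definition boolfun (n : nat) := bits n -> bool.

Definition AND (n : nat) : boolfun n := fun x => [forall i, x i].

(* [s] permutes the inputs, [c] marks the negated ones and [b] tells whether
   the output is negated. *)
Definition isomorphic (n : nat) (f g : boolfun n) : Prop :=
  exists (s : 'S_n) (c : bits n) (b : bool),
    forall x : bits n, g x = f [ffun i => x (s i) (+) c i] (+) b.

(* For R : realType, R[i] is the field of complex numbers.  The Hilbert space is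
   R[i]^d with its standard basis, states being column vectors.  [qa_first] is
   U_1 and [qa_rest] is U_2, ..., U_{t+1}; one query is made before each element
   of [qa_rest], so there are exactly [t] of them.  [qa_index k = None] when the
   basis state k is associated with no index. *)
Record query_algorithm (R : realType) (n t : nat) := QueryAlgorithm {
  qa_dim : nat;
  qa_start : 'cV[R[i]]_qa_dim;
  qa_first : 'M[R[i]]_qa_dim;
  qa_rest : t.-tuple 'M[R[i]]_qa_dim;
  qa_index : 'I_qa_dim -> option 'I_n;
  qa_output : 'I_qa_dim -> bool;
  qa_start_unit : \sum_(k < qa_dim) `|qa_start k 0| ^+ 2 = 1;
  qa_first_unitary : qa_first \is unitarymx;
  qa_rest_unitary : all (fun U => U \is unitarymx) qa_rest
}.

Arguments qa_start {R n t} _.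
Arguments qa_first {R n t} _.
Arguments qa_rest {R n t} _.
Arguments qa_index {R n t} _ _.
Arguments qa_output {R n t} _ _.

Section Run.
Variables (R : realType) (n t : nat) (A : query_algorithm R n t) (x : bits n).

Definition query_op : 'M[R[i]]_(qa_dim A) :=
  diag_mx (\row_k (if qa_index A k is Some i then (-1) ^+ x i else 1)).

Definition final_state : 'cV[R[i]]_(qa_dim A) :=
  foldl (fun psi U => U *m (query_op *m psi))
        (qa_first A *m qa_start A) (qa_rest A).

(* A nonnegative real, although typed in R[i] like the norm on R[i]. *)
Definition output_prob (b : bool) : R[i] :=
  \sum_(k < qa_dim A | qa_output A k == b) `|final_state k 0| ^+ 2.

End Run.

Definition exactly_computes (R : realType) (n t : nat)
    (A : query_algorithm R n t) (f : boolfun n) : Prop :=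
  forall x : bits n, output_prob A x (f x) = 1.

Definition exact_queries (R : realType) (n : nat) (f : boolfun n) (t : nat) :=
  exists A : query_algorithm R n t, exactly_computes A f.

(* The graph of Q_E: [is_QE R f m] reads Q_E(f) = m, the minimum being both
   attained and a lower bound, so no default value is involved. *)
Definition is_QE (R : realType) (n : nat) (f : boolfun n) (m : nat) : Prop :=
  exact_queries R f m /\ forall t : nat, exact_queries R f t -> (m <= t)%N.

(* Main.v *)
(* A function is isomorphic to AND_n iff it is constant except at one point, a
   "spike".

   Lower bound: after t queries the amplitudes are polynomials of degree at most
   t in the signs (-1)^(x_i).  In an exact algorithm for a spike at p, an
   amplitude leading to the exceptional answer is supported on {p}, so it has
   degree n, or is 0.

   Upper bound: a function f on n >= 3 bits which is not a spike needs at most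
   n - 1 queries.  For n >= 4, some query x_i or x_i xor x_j (one quantum query)
   leaves two functions on n - 1 bits which are not spikes, and one concludes by
   induction.  For n = 3, the first query either is of this form or is the first
   step of the Ambainis-Iraids-Smotrovs algorithm for "two of four bits are 1";
   the choice is found by computation for each of the 256 functions. *)
From HB Require Import structures.
Require Import Defs.
From mathcomp Require Import all_boot all_order all_algebra all_fingroup.
From mathcomp Require Import reals complex ring.
From mathcomp Require boolp.

Set Implicit Arguments.
Unset Strict Implicit.
Unset Printing Implicit Defensive.

Import Order.TTheory GRing.Theory Num.Theory.
Local Open Scope sesquilinear_scope.
Local Open Scope complex_scope.
Local Open Scope ring_scope.

(** * Exact algorithms with promises *)

Definition case_split T d1 d2 (g1 : 'I_d1 -> T) (g2 : 'I_d2 -> T) (k : 'I_(d1 + d2)) :=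
  match split k with inl j => g1 j | inr j => g2 j end.

Lemma case_splitl T d1 d2 (g1 : 'I_d1 -> T) (g2 : 'I_d2 -> T) k :
  case_split g1 g2 (lshift d2 k) = g1 k.
Proof. by rewrite /case_split -[lshift d2 k]/(unsplit (inl k)) unsplitK. Qed.

Lemma case_splitr T d1 d2 (g1 : 'I_d1 -> T) (g2 : 'I_d2 -> T) k :
  case_split g1 g2 (rshift d1 k) = g2 k.
Proof. by rewrite /case_split -[rshift d1 k]/(unsplit (inr k)) unsplitK. Qed.

Section Solves.
Variables (R : realType) (n : nat).
Implicit Types (f : boolfun n) (x : bits n).

Definition phase (q : option 'I_n) x : R :=
  if q is Some i then (-1) ^+ x i else 1.

Definition oracle d (h : 'I_d -> option 'I_n) x : 'M[R]_d :=
  diag_mx (\row_k phase (h k) x).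

Fixpoint run d (h : 'I_d -> option 'I_n) (U : nat -> 'M[R]_d) x t (v : 'cV_d) :=
  if t is t'.+1 then run h (fun j => U j.+1) x t' (U 0%N *m (oracle h x *m v))
  else v.

(* [iota x] is the state reached on input [x] so far, not necessarily of norm 1:
   an input with [iota x = 0] is excluded, so [solves] expresses promise
   problems as well.  Real amplitudes suffice for all upper bounds. *)
Definition solves f t m (iota : bits n -> 'cV[R]_m) : Prop :=
  exists d (V : 'M[R]_(d, m)) (U : nat -> 'M[R]_d)
      (h : 'I_d -> option 'I_n) (o : 'I_d -> bool),
  [/\ V^T *m V = 1%:M, forall j, (U j)^T *m U j = 1%:M
    & forall x k, o k != f x -> run h U x t (V *m iota x) k 0 = 0].

Lemma oracleE d (h : 'I_d -> option 'I_n) x (v : 'cV_d) k :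
  (oracle h x *m v) k 0 = phase (h k) x * v k 0.
Proof. by rewrite mul_diag_mx !mxE. Qed.

Lemma run_scale d h U x t (v : 'cV_d) (a : R) :
  run h U x t (a *: v) = a *: run h U x t v.
Proof. by elim: t U v => //= t IH U v; rewrite -!scalemxAr IH. Qed.

Lemma run0 d h U x t : run h U x t (0 : 'cV_d) = 0.
Proof. by rewrite -[X in run _ _ _ _ X](scale0r 0) run_scale scale0r. Qed.

Lemma oracle_col d1 d2 (h1 : 'I_d1 -> _) (h2 : 'I_d2 -> _) x (v1 : 'cV_d1) (v2 : 'cV_d2) :
  oracle (case_split h1 h2) x *m col_mx v1 v2 =
  col_mx (oracle h1 x *m v1) (oracle h2 x *m v2).
Proof.
apply/colP => k; rewrite oracleE; case: (splitP k) => j kj.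
  have -> : k = lshift d2 j by apply: val_inj.
  by rewrite case_splitl !col_mxEu oracleE.
have -> : k = rshift d1 j by apply: val_inj.
by rewrite case_splitr !col_mxEd oracleE.
Qed.

Lemma run_block d1 d2 (h1 : 'I_d1 -> _) (h2 : 'I_d2 -> _) U1 U2 x t v1 v2 :
  run (case_split h1 h2) (fun j => block_mx (U1 j) 0 0 (U2 j)) x t (col_mx v1 v2) =
  col_mx (run h1 U1 x t v1) (run h2 U2 x t v2).
Proof.
elim: t U1 U2 v1 v2 => //= t IH U1 U2 v1 v2.
by rewrite -IH oracle_col mul_block_col !mul0mx addr0 add0r.
Qed.

Lemma solves_ext f t m (i1 i2 : bits n -> 'cV[R]_m) :
  i1 =1 i2 -> solves f t i1 -> solves f t i2.
Proof.
move=> e [d [V [U [h [o [hV hU ho]]]]]]; exists d, V, U, h, o; split=> // x k.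
by rewrite -e; apply: ho.
Qed.

Lemma solves_isometry f t m m' (W : 'M[R]_(m', m)) (iota : bits n -> 'cV_m) :
  W^T *m W = 1%:M -> solves f t (fun x => W *m iota x) -> solves f t iota.
Proof.
move=> hW [d [V [U [h [o [hV hU ho]]]]]]; exists d, (V *m W), U, h, o.
split=> // [|x k ok]; last by rewrite -mulmxA ho.
by rewrite trmx_mul -mulmxA [V^T *m _]mulmxA hV mul1mx.
Qed.

(** Correctness only asks that wrong outcomes have amplitude 0, input by input; hence the factor may
    depend on [x]. *)
Lemma solves_scale f t m (iota : bits n -> 'cV[R]_m) (a : bits n -> R) :
  solves f t iota -> solves f t (fun x => a x *: iota x).
Proof.
move=> [d [V [U [h [o [hV hU ho]]]]]]; exists d, V, U, h, o; split=> // x k ok.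
by rewrite -scalemxAr run_scale mxE ho ?mulr0.
Qed.

Lemma block_diag_orthogonal p q r s (A : 'M[R]_(p, r)) (B : 'M[R]_(q, s)) :
    A^T *m A = 1%:M -> B^T *m B = 1%:M ->
  (block_mx A 0 0 B)^T *m block_mx A 0 0 B = 1%:M.
Proof.
move=> hA hB; rewrite tr_block_mx mulmx_block !trmx0 !mulmx0 !mul0mx hA hB.
by rewrite !addr0 !add0r -scalar_mx_block.
Qed.

Lemma solves_col f t m1 m2 (i1 : bits n -> 'cV[R]_m1) (i2 : bits n -> 'cV_m2) :
  solves f t i1 -> solves f t i2 -> solves f t (fun x => col_mx (i1 x) (i2 x)).
Proof.
move=> [d1 [V1 [U1 [h1 [o1 [hV1 hU1 ho1]]]]]] [d2 [V2 [U2 [h2 [o2 [hV2 hU2 ho2]]]]]].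
exists (d1 + d2)%N, (block_mx V1 0 0 V2), (fun j => block_mx (U1 j) 0 0 (U2 j)).
exists (case_split h1 h2), (case_split o1 o2); split.
- exact: block_diag_orthogonal.
- by move=> j; apply: block_diag_orthogonal.
move=> x k; rewrite mul_block_col !mul0mx addr0 add0r.
rewrite run_block.
case: (splitP k) => j kj.
  have -> : k = lshift d2 j by apply: val_inj.
  by rewrite case_splitl col_mxEu; apply: ho1.
have -> : k = rshift d1 j by apply: val_inj.
by rewrite case_splitr col_mxEd; apply: ho2.
Qed.

(* The isometry V of the remaining algorithm need not be square, so it is
   dilated to an orthogonal matrix on the direct sum of its source and target. *)
Lemma dilation_orthogonal d m (V : 'M[R]_(d, m)) : V^T *m V = 1%:M ->
  (block_mx 0 V^T V (1%:M - V *m V^T))^T *m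
    block_mx 0 V^T V (1%:M - V *m V^T) = 1%:M.
Proof.
move=> hV; rewrite tr_block_mx trmx0 trmxK linearB /= trmx1 trmx_mul trmxK.
have VP : V^T *m (1%:M - V *m V^T) = 0.
  by rewrite mulmxBr mulmx1 mulmxA hV mul1mx subrr.
have PV : (1%:M - V *m V^T) *m V = 0.
  by rewrite mulmxBl mul1mx -mulmxA hV mulmx1 subrr.
rewrite mulmx_block !mul0mx !mulmx0 hV VP PV !add0r.
have -> : (1%:M - V *m V^T) *m (1%:M - V *m V^T) = 1%:M - V *m V^T.
  by rewrite [LHS]mulmxBl mul1mx -mulmxA VP mulmx0 subr0.
by rewrite addrC subrK -scalar_mx_block.
Qed.

(** The query happens in the first summand of a direct sum; the dilation then moves the state
    through [V] into the second, where the remaining algorithm runs. The first summand is left with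
    amplitude 0, so its output is arbitrary. *)
Lemma solves_query f t m (h : 'I_m -> option 'I_n) (iota : bits n -> 'cV[R]_m) :
  solves f t (fun x => oracle h x *m iota x) -> solves f t.+1 iota.
Proof.
move=> [d [V [U [hs [o [hV hU ho]]]]]].
exists (m + d)%N, (col_mx 1%:M 0).
exists (fun j => if j is j'.+1 then block_mx 1%:M 0 0 (U j')
                 else block_mx 0 V^T V (1%:M - V *m V^T)).
exists (case_split h hs), (case_split (fun=> false) o); split.
- by rewrite tr_col_mx trmx0 trmx1 mul_row_col mulmx1 mulmx0 addr0.
- case=> [|j]; first exact: dilation_orthogonal.
  by apply: block_diag_orthogonal => //; rewrite trmx1 mulmx1.
move=> x k /=; rewrite [col_mx 1%:M 0 *m _]mul_col_mx mul1mx mul0mx.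
rewrite oracle_col mulmx0.
rewrite mul_block_col !mulmx0 !addr0 mul0mx.
rewrite (run_block h hs (fun=> 1%:M) U).
case: (splitP k) => j kj; last first.
  have -> : k = rshift m j by apply: val_inj.
  by rewrite case_splitr col_mxEd; apply: ho.
have -> : k = lshift d j by apply: val_inj.
by move=> _; rewrite col_mxEu run0 mxE.
Qed.

Definition solves_on f t (D : pred (bits n)) : Prop :=
  solves f t (fun x => (D x)%:R%:M : 'cV[R]_1).

Lemma solves_on_support f t (D : pred (bits n)) (a : bits n -> R) :
    (forall x, a x != 0 -> D x) -> solves_on f t D ->
  solves f t (fun x => (a x)%:M : 'cV[R]_1).
Proof.
move=> aD /(solves_scale a); apply: solves_ext => x.
rewrite scale_scalar_mx; have [->|/aD->] := eqVneq (a x) 0; first by rewrite mul0r.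
by rewrite mulr1.
Qed.

Lemma solves_on_sub f t (D D' : pred (bits n)) :
  {subset D <= D'} -> solves_on f t D' -> solves_on f t D.
Proof.
move=> DD'; apply: solves_on_support => x.
by rewrite pnatr_eq0 eqb0 negbK => /DD'.
Qed.

Lemma solves_const f t (D : pred (bits n)) b :
  {in D, forall x, f x = b} -> solves_on f t D.
Proof.
move=> fD; exists 1%N, 1%:M, (fun=> 1%:M), (fun=> None), (fun=> b).
split=> [|j|x k]; rewrite ?trmx1 ?mulmx1 // mul1mx.
case: (boolP (D x)) => [/fD-> /eqP//|_ _].
by rewrite raddf0 run0 mxE.
Qed.

(** This plays the role of an intermediate measurement: each outcome is followed by its own
    algorithm, all acting on one direct sum. *)
Lemma solves_coords f t m (iota : bits n -> 'cV[R]_m) :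
  (forall w, solves f t (fun x => (iota x w 0)%:M : 'cV[R]_1)) -> solves f t iota.
Proof.
elim: m iota => [|m IH] iota hi.
  exists 1%N, 0, (fun=> 1%:M), (fun=> None), (fun=> true).
  split=> [|j|x k _]; rewrite ?trmx1 ?mulmx1 //; first by apply/matrixP => - [].
  by rewrite mul0mx run0 mxE.
have h0 := hi (lshift m (0 : 'I_1)).
have h1 : solves f t (fun x => dsubmx (iota x : 'cV_(1 + m))).
  by apply: IH => w; apply: solves_ext (hi (rshift 1 w)) => x; rewrite mxE.
apply: solves_ext (solves_col h0 h1) => x.
rewrite -[RHS](@vsubmxK _ 1 m); congr col_mx.
by apply/colP => k; rewrite !mxE !ord1 /= mulr1n.
Qed.

(* One query to the state v followed by the isometry W: outcome w has
   amplitude sum_i W_wi phase_i v_i, so it excludes the inputs where this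
   vanishes. *)
Lemma solves_step f t (D : pred (bits n)) m k (h : 'I_m -> option 'I_n)
    (v : 'cV[R]_m) (W : 'M[R]_(k, m)) (E : 'I_k -> pred (bits n)) :
    v^T *m v = 1%:M -> W^T *m W = 1%:M ->
    (forall w x, D x -> \sum_i W w i * (phase (h i) x * v i 0) != 0 -> E w x) ->
    (forall w, solves_on f t [pred x | D x && E w x]) ->
  solves_on f t.+1 D.
Proof.
move=> hv hW hE hs; apply: (solves_isometry hv); apply: (solves_query (h := h)).
apply: (solves_isometry hW); apply: solves_coords => w.
apply: (solves_on_support _ (hs w)) => x /=.
have -> : (W *m (oracle h x *m (v *m (D x)%:R%:M))) w 0 =
   (D x)%:R * \sum_i W w i * (phase (h i) x * v i 0).
  rewrite mxE mulr_sumr; apply: eq_bigr => i _.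
  by rewrite oracleE mul_mx_scalar mxE; ring.
case: (boolP (D x)) => [Dx|_]; last by rewrite mul0r eqxx.
by rewrite mul1r; apply: hE.
Qed.

Definition literal (q : bool * option 'I_n) x : bool :=
  q.1 (+) (if q.2 is Some i then x i else false).

(* The state (1/2) sum_a y_a |a>, with y_a the signs of four literals, is
   measured in the frame made of the six (|a> - |b>)/2 and of (1/2) sum_a |a>:
   the first outcomes certify that two literals differ, the last one that the
   four literals are not balanced. *)
Lemma solves_four f t (D : pred (bits n)) (q : 'I_4 -> bool * option 'I_n) :
    (forall a b : 'I_4, (a < b)%N ->
       solves_on f t [pred x | D x && (literal (q a) x != literal (q b) x)]) ->
    solves_on f t [pred x | D x && (\sum_a literal (q a) x != 2)%N] ->
  solves_on f t.+1 D.
Proof.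
move=> hpair hsum.
pose o (i : nat) : 'I_4 := inord i.
have big4 T (idx : T) (op : Monoid.law idx) (F : 'I_4 -> T) :
    \big[op/idx]_i F i = op (F (o 0)) (op (F (o 1)) (op (F (o 2)) (F (o 3))))%N.
  rewrite !big_ord_recl big_ord0 Monoid.mulm1.
  by congr (op (F _) (op (F _) (op (F _) (F _)))); apply: val_inj; rewrite /= inordK.
pose s : seq ('I_4 * 'I_4) := [:: (o 0, o 1); (o 0, o 2); (o 0, o 3);
  (o 1, o 2); (o 1, o 3); (o 2, o 3)]%N.
pose W : 'M[R]_(7, 4) := \matrix_(w, i)
  if (w < 6)%N then ((i == (nth (o 0%N, o 0%N) s w).1)%:R
                     - (i == (nth (o 0%N, o 0%N) s w).2)%:R) / 2
  else 2^-1.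
pose v : 'cV[R]_4 := \col_i ((-1) ^+ (q i).1 / 2).
pose E (w : 'I_7) : pred (bits n) := fun x =>
  if (w < 6)%N then literal (q (nth (o 0%N, o 0%N) s w).1) x
                    != literal (q (nth (o 0%N, o 0%N) s w).2) x
  else (\sum_a literal (q a) x != 2)%N.
apply: (@solves_step f t D 4 7 (fun a => (q a).2) v W E).
- apply/matrixP => i j; rewrite !ord1 !mxE.
  rewrite (eq_bigr (fun=> 2^-1 ^+ 2)); last first.
    by move=> k _; rewrite !mxE -expr2 exprMn sqrr_sign mul1r.
  by rewrite sumr_const card_ord /=; field.
(* On the diagonal, three pairs and the uniform row give 3/4 + 1/4; off it, one pair and the uniform
   row give -1/4 + 1/4. *)
- apply/matrixP => i j; rewrite !mxE.
  under eq_bigr do rewrite !mxE.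
  rewrite !big_ord_recl big_ord0 /= /bump /=.
  case: i => - [|[|[|[|//]]]] i3; case: j => - [|[|[|[|//]]]] j3;
    rewrite -!val_eqE /= !inordK //=; by field.
- move=> w x _; rewrite /E.
  have -> : \sum_i W w i * (phase (q i).2 x * v i 0) =
     \sum_i W w i * ((-1) ^+ literal (q i) x / 2).
    apply: eq_bigr => i _; congr (_ * _); rewrite mxE /literal signr_addb mulrA.
    by congr (_ / _); rewrite mulrC; congr (_ * _); rewrite /phase; case: (q i).2.
  rewrite !big4 !mxE /=.
  case: w => - [|[|[|[|[|[|[|//]]]]]]] w7 /=; rewrite -?val_eqE /= ?inordK //=;
  move: (literal (q (o 0%N)) x) (literal (q (o 1%N)) x) (literal (q (o 2%N)) x)
    (literal (q (o 3%N)) x) => [] [] [] [] //=; apply: contraNT => _;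
  apply/eqP; by field.
- case=> - [|[|[|[|[|[|[|//]]]]]]] w7; rewrite /E /=; first [exact: hsum | apply: hpair].
  all: by rewrite /= !inordK.
Qed.

End Solves.

(** Apply [solves_four] to the literals a, a, b, b: a differing pair certifies xor 1, an unbalanced
    sum certifies xor 0. With [None] as constant 0, this covers single bits. *)
Lemma solves_branch (R : realType) n (f : boolfun n) t (D : pred (bits n))
    (a b : option 'I_n) :
    (forall c, solves_on R f t
       [pred x | D x && (literal (false, a) x (+) literal (false, b) x == c)]) ->
  solves_on R f t.+1 D.
Proof.
move=> hab.
pose q (k : 'I_4) := (false, if (k < 2)%N then a else b).
apply: (@solves_four R n f t D q) => [k l _|].
  apply: solves_on_sub (hab true) => x; rewrite !inE /= /q => /andP [->].
  by case: ifP => _; case: ifP => _; rewrite ?eqxx //= eqb_id; case: literal; case: literal.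
apply: solves_on_sub (hab false) => x; rewrite !inE /= /q !big_ord_recl big_ord0 /=.
by case: (literal (_, a)) (literal (_, b)) => [] [].
Qed.

Definition solvable (R : realType) n (f : boolfun n) t := solves_on R f t predT.

Lemma solves_relabel (R : realType) n m (g : boolfun m) (f : boolfun n) t
    (s : 'I_m -> 'I_n) (D : pred (bits n)) :
    solvable R g t ->
    {in D, forall x, f x = g [ffun i => x (s i)]} ->
  solves_on R f t D.
Proof.
move=> [d [V [U [h [o [hV hU ho]]]]]] fg.
exists d, V, U, (fun k => omap s (h k)), o; split=> // x k.
case: (boolP (D x)) => [Dx|_ _]; last first.
  by rewrite raddf0 mulmx0 run0 mxE.
rewrite fg // => /ho; congr (_ = _); congr (fun_of_matrix _ _ _).
elim: t U (V *m _) {hU ho fg} => //= t IH U v; rewrite -IH; congr (run _ _ _ _ (_ *m _)).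
apply/colP => l; rewrite !oracleE; congr (_ * _).
by rewrite /phase; case: (h l) => //= i; rewrite ffunE.
Qed.

(** * From real amplitudes to complex exact algorithms *)

Section RealToComplex.
Variables (R : realType) (n : nat).

Lemma foldl_run d (h : 'I_d -> option 'I_n) (U : nat -> 'M[R]_d) (x : bits n) t v :
  foldl (fun psi M => M *m
     (diag_mx (\row_k (if h k is Some i then (-1) ^+ x i else 1)) *m psi))
    (map_mx (real_complex R) v) [seq map_mx (real_complex R) (U j) | j <- iota 0 t] =
  map_mx (real_complex R) (run h U x t v).
Proof.
elim: t U v => //= t IH U v.
rewrite (iotaDl 1 0) -map_comp -IH; congr (foldl _ _ _).
rewrite !map_mxM; congr (_ *m (_ *m _)).
rewrite map_diag_mx; congr diag_mx; apply/rowP => k; rewrite !mxE /phase.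
by case: (h k) => [i|]; rewrite ?rmorphXn ?rmorphN rmorph1.
Qed.

Lemma oracle_orthogonal d (h : 'I_d -> option 'I_n) (x : bits n) :
  (oracle R h x)^T *m oracle R h x = 1%:M.
Proof.
rewrite tr_diag_mx mulmx_diag -diag_const_mx; congr diag_mx.
apply/rowP => k; rewrite !mxE /phase; case: (h k) => [i|]; last exact: mulr1.
by rewrite -expr2 sqrr_sign.
Qed.

Lemma run_norm d (h : 'I_d -> option 'I_n) (U : nat -> 'M[R]_d) (x : bits n) t v :
    (forall j, (U j)^T *m U j = 1%:M) ->
  (run h U x t v)^T *m run h U x t v = v^T *m (v : 'cV_d).
Proof.
elim: t U v => //= t IH U v hU; rewrite IH //.
rewrite !trmx_mul -!mulmxA (mulmxA (U 0%N)^T) hU mul1mx.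
by rewrite (mulmxA (oracle R h x)^T) oracle_orthogonal mul1mx.
Qed.

(** The one-column isometry [V] becomes the starting state and U_1 the identity. The norm stays 1
    and wrong outcomes have amplitude 0, so the right ones have total probability 1. *)
Lemma solvable_exact_queries (f : boolfun n) t : solvable R f t -> exact_queries R f t.
Proof.
move=> [d [V [U [h [o [hV hU ho]]]]]].
have norm2 (v : 'cV[R]_d) (P : pred 'I_d) :
    \sum_(k | P k) `|map_mx (real_complex R) v k 0| ^+ 2 =
    real_complex R (\sum_(k | P k) v k 0 ^+ 2).
  rewrite rmorph_sum; apply: eq_bigr => k _; rewrite mxE.
   by rewrite normc_def /= expr0n /= addr0 sqrtr_sqr -rmorphXn real_normK ?num_real.
have normE (v : 'cV[R]_d) : \sum_k v k 0 ^+ 2 = (v^T *m v) 0 0.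
  by rewrite mxE; apply: eq_bigr => k _; rewrite mxE expr2.
have unitaryC (M : 'M[R]_d) : M^T *m M = 1%:M -> map_mx (real_complex R) M \is unitarymx.
  move=> hM; apply/unitarymxP.
  suff -> : (map_mx (real_complex R) M)^t* = map_mx (real_complex R) M^T.
    by rewrite -map_mxM (mulmx1C hM) map_mx1.
  by apply/matrixP => i j; rewrite !mxE; exact: conjc_real.
have su : \sum_(k < d) `|(map_mx (real_complex R) V) k 0| ^+ 2 = 1.
  by rewrite norm2 normE hV mxE rmorph1.
have fu : (map_mx (real_complex R) 1%:M : 'M_d) \is unitarymx.
  by apply: unitaryC; rewrite trmx1 mulmx1.
pose r := [tuple of [seq map_mx (real_complex R) (U j) | j <- iota_tuple t 0]].
have ru : all (fun M => M \is unitarymx) r.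
  by apply/allP => M /mapP [j _ ->]; apply: unitaryC.
exists (@QueryAlgorithm R n t d _ _ r h o su fu ru) => x.
rewrite /output_prob /final_state /query_op /=.
rewrite map_mx1 mul1mx (foldl_run h) norm2.
rewrite (_ : \sum_(k | o k == f x) _ = 1) ?rmorph1 //.
have : \sum_k run h U x t V k 0 ^+ 2 = 1 by rewrite normE run_norm // hV mxE.
rewrite (bigID (fun k => o k == f x)) /= [X in _ + X]big1 ?addr0 // => k ok.
by have := ho x k ok; rewrite mulmx1 => ->; rewrite expr0n.
Qed.

End RealToComplex.

(** * Lower bound *)

Definition spike n (f : boolfun n) : bool :=
  [exists p : bits n, exists v : bool, [forall x, f x == v (+) (x == p)]].

Lemma spikeP n (f : boolfun n) :
  reflect (exists p v, forall x, f x = v (+) (x == p)) (spike f).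
Proof.
apply: (iffP existsP) => [[p /existsP [v /forallP h]]|[p [v h]]]; exists p.
  by exists v => x; apply/eqP.
by apply/existsP; exists v; apply/forallP => x; rewrite h.
Qed.

(** The spike is the image of the all-ones input. Conversely, input negations alone move that input
    to any point, so the identity permutation suffices. *)
Lemma isomorphic_AND n (f : boolfun n) : isomorphic f (@AND n) <-> spike f.
Proof.
split=> [[s [c [b h]]]|/spikeP [p [v h]]].
  apply/spikeP; exists [ffun i => ~~ c i], b => x.
  have [y ->] : exists y : bits n, x = [ffun i => y (s i) (+) c i].
    exists [ffun j => x (s^-1%g j) (+) c (s^-1%g j)].
    by apply/ffunP => i; rewrite !ffunE permK addbK.
  rewrite -[LHS](addbK b) -h addbC; congr (_ (+) _).
  apply/forallP/eqP => [hy|e i].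
    by apply/ffunP => i; rewrite !ffunE hy.
  by have /ffunP/(_ (s^-1%g i)) := e; rewrite !ffunE permKV; case: (y i); case: (c _).
exists 1%g, [ffun i => ~~ p i], v => x.
rewrite h addbC addKb; apply/forallP/eqP => [hx|e i].
  by apply/ffunP => i; have := hx i; rewrite !ffunE perm1; case: (x i); case: (p i).
by have /ffunP/(_ i) := e; rewrite !ffunE perm1; case: (x i); case: (p i).
Qed.

Section LowerBound.
Variables (R : realType) (n : nat).
Local Notation C := R[i].

Definition chi (S : {set 'I_n}) (x : bits n) : C := \prod_(i in S) (-1) ^+ x i.

(* The Fourier coefficients of [a] of order greater than [t] vanish, that is, [a]
   is a polynomial of degree at most [t] in the signs (-1)^(x_i). *)
Definition low_degree t (a : bits n -> C) : Prop :=
  forall S : {set 'I_n}, (t < #|S|)%N -> \sum_x chi S x * a x = 0.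

(** Flipping a bit of [S] changes the sign of [chi S], so its sum equals its opposite. *)
Lemma low_degree_cst c : low_degree 0 (fun=> c).
Proof.
move=> S /card_gt0P [i iS]; rewrite -mulr_suml.
suff -> : \sum_x chi S x = 0 by rewrite mul0r.
pose flip (x : bits n) : bits n := [ffun j => x j (+) (j == i)].
have flipK : involutive flip.
  by move=> x; apply/ffunP => j; rewrite !ffunE addbK.
have e : \sum_x chi S x = - \sum_x chi S x.
  rewrite {1}(reindex_inj (inv_inj flipK)) -sumrN; apply: eq_bigr => x _.
  rewrite /chi (bigD1 i) //= [in RHS](bigD1 i) //= ffunE eqxx signr_addb mulrN1 mulNr.
  congr (- (_ * _)); apply: eq_bigr => j /andP [_ /negbTE ji].
  by rewrite ffunE ji addbF.
by apply/eqP; rewrite -eqNr -e.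
Qed.

Lemma low_degree_sum t m (M : 'I_m -> C) (a : 'I_m -> bits n -> C) :
  (forall l, low_degree t (a l)) -> low_degree t (fun x => \sum_l M l * a l x).
Proof.
move=> ha S tS; under eq_bigr do rewrite mulr_sumr.
rewrite exchange_big big1 //= => l _.
under eq_bigr do rewrite mulrCA.
by rewrite -mulr_sumr ha // mulr0.
Qed.

(** The sign of bit [i] turns [chi S] into the character of [S] with [i] toggled, whose order is
    smaller by at most one. *)
Lemma low_degree_query t (a : bits n -> C) (q : option 'I_n) : low_degree t a ->
  low_degree t.+1 (fun x => (if q is Some i then (-1) ^+ x i else 1) * a x).
Proof.
move=> ha S tS; case: q => [i|]; last first.
  by under eq_bigr do rewrite mul1r; apply: ha; apply: ltnW.
have [iS|iS] := boolP (i \in S).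
  rewrite -[RHS](ha (S :\ i)); last by move: tS; rewrite (cardsD1 i) iS ltnS.
  apply: eq_bigr => x _; rewrite mulrA; congr (_ * _).
  by rewrite /chi (big_setD1 i) //= mulrAC -expr2 sqrr_sign mul1r.
rewrite -[RHS](ha (i |: S)); last by rewrite cardsU1 iS ltnW // ltnW.
apply: eq_bigr => x _; rewrite mulrA; congr (_ * _).
by rewrite /chi big_setU1 //= mulrC.
Qed.

Variables (t : nat) (A : query_algorithm R n t).

Lemma low_degree_final k : low_degree t (fun x => final_state A x k 0).
Proof.
rewrite /final_state; set r := qa_rest A; set v := qa_first A *m _.
have foldl_low (l : seq 'M[C]_(qa_dim A)) s (psi : bits n -> 'cV_(qa_dim A)) :
    (forall k, low_degree s (fun x => psi x k 0)) ->
  forall k, low_degree (s + size l)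
    (fun x => foldl (fun phi U => U *m (query_op A x *m phi)) (psi x) l k 0).
  elim: l s psi => [|U l IH] s psi hpsi k' /=; first by rewrite addn0; apply: hpsi.
  rewrite addnS -addSn.
  apply: (IH _ (fun x => U *m (query_op A x *m psi x))) => {}k'.
  under [X in low_degree _ X]boolp.funext => x do rewrite mxE.
  apply: low_degree_sum => j; rewrite /query_op.
  under [X in low_degree _ X]boolp.funext => x do rewrite mul_diag_mx !mxE.
  exact: low_degree_query.
have := foldl_low r 0%N (fun=> v) (fun l => low_degree_cst _) k.
by rewrite add0n size_tuple.
Qed.

Lemma norm2E d (v : 'cV[C]_d) : \sum_k `|v k 0| ^+ 2 = (v^t* *m v) 0 0.
Proof. by rewrite mxE; apply: eq_bigr => k _; rewrite !mxE normCKC. Qed.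

Lemma unitary_norm2 d (U : 'M[C]_d) (v : 'cV[C]_d) : U \is unitarymx ->
  \sum_k `|(U *m v) k 0| ^+ 2 = \sum_k `|v k 0| ^+ 2.
Proof.
move=> /unitarymxP hU; rewrite !norm2E trmx_mul map_mxM.
by rewrite -mulmxA (mulmxA _ U) (mulmx1C hU) mul1mx.
Qed.

Lemma final_state_unit x : \sum_k `|final_state A x k 0| ^+ 2 = 1.
Proof.
rewrite /final_state.
have : \sum_k `|(qa_first A *m qa_start A) k 0| ^+ 2 = 1.
  by rewrite unitary_norm2 ?qa_first_unitary // qa_start_unit.
move: (_ *m _) (qa_rest_unitary A) => v; elim: (tval _) v => //= U r IH v.
case/andP => hU hr hv; apply: IH => //; rewrite unitary_norm2 // -[RHS]hv.
apply: eq_bigr => k _; rewrite mul_diag_mx !mxE normrM.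
by case: qa_index => [i|]; rewrite ?normrX ?normrN normr1 ?expr1n mul1r.
Qed.

Lemma spike_lower_bound (f : boolfun n) : spike f -> exactly_computes A f -> (n <= t)%N.
Proof.
move=> /spikeP [p [v h]] hA; rewrite leqNgt; apply/negP => tn.
have amp0 x k : x != p -> qa_output A k != v -> final_state A x k 0 = 0.
  move=> /negbTE xp kv; have := final_state_unit x.
  rewrite (bigID (fun k => qa_output A k == v)) /=.
  have := hA x; rewrite /output_prob h xp addbF => -> /eqP.
  rewrite -subr_eq0 addrAC subrr add0r psumr_eq0 => [/allP/(_ k)|l _].
    by rewrite mem_index_enum kv /= => /(_ isT); rewrite sqrf_eq0 normr_eq0 => /eqP.
  exact: exprn_ge0.
(* The amplitude vanishes off [p], so its Fourier coefficient of order n is, up to sign, its value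
   at [p]; it is 0 because t < n. *)
have amp0p k : qa_output A k != v -> final_state A p k 0 = 0.
  move=> kv; have := @low_degree_final k setT; rewrite cardsT card_ord => /(_ tn).
  rewrite (bigD1 p) //= big1 => [|x xp]; last by rewrite amp0 // mulr0.
  move=> /eqP; rewrite addr0 mulf_eq0 => /orP [|/eqP //].
  by rewrite /chi prodf_seq_eq0 => /hasP [i _ /andP [_]]; rewrite signr_eq0.
have := hA p; rewrite /output_prob h eqxx big1 => [/eqP|k /eqP ok].
  by rewrite eq_sym oner_eq0.
by rewrite amp0p ?normr0 ?expr0n // ok addbT; case: (v).
Qed.

End LowerBound.

(** * Reducing the number of bits *)

Definition insert_bit n (b : 'I_n.+1) (e : bool) (z : bits n) : bits n.+1 :=
  [ffun j => if unlift b j is Some k then z k else e].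

(** The restriction of [f] to the half where x_b xor x_a = c, with bit [b] eliminated; [a] is
    numbered among the remaining bits, and [None] gives x_b = c. *)
Definition xor_restr n (f : boolfun n.+1) b (a : option 'I_n) (c : bool) : boolfun n :=
  fun z => f (insert_bit b (c (+) literal (false, a) z) z).

Lemma insert_bitK n (x : bits n.+1) b :
  insert_bit b (x b) [ffun i => x (lift b i)] = x.
Proof.
by apply/ffunP => j; rewrite ffunE; case: unliftP => [k|] -> //; rewrite ffunE.
Qed.

Lemma literal_drop n (x : bits n.+1) b (a : option 'I_n) :
  literal (false, a) [ffun i => x (lift b i)] = literal (false, omap (lift b) a) x.
Proof. by rewrite /literal; case: a => //= k; rewrite ffunE. Qed.

Lemma solvable_xor_restr (R : realType) n (f : boolfun n.+1) b a t :
  (forall c, solvable R (xor_restr f b a c) t) -> solvable R f t.+1.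
Proof.
move=> h; apply: (solves_branch (a := Some b) (b := omap (lift b) a)) => c.
apply: (@solves_relabel R n.+1 n _ f t (lift b) _ (h c)) => x.
rewrite inE /= => /eqP <-; rewrite /xor_restr literal_drop -addbA addbb addbF.
by rewrite [literal (_, Some b) x]/literal /= insert_bitK.
Qed.

Lemma solvable_all (R : realType) n (f : boolfun n) : solvable R f n.
Proof.
elim: n f => [|n IH] f; last by apply: (@solvable_xor_restr R n f ord0 None) => c.
apply: (@solves_const R 0 f 0 predT (f [ffun=> false])) => x _.
by congr f; apply/ffunP => - [].
Qed.

(** Spikes are lifted back to the full cube so that halves cut in different directions can be
    compared. *)
Lemma spike_xor_restr n (f : boolfun n.+1) b a c : spike (xor_restr f b a c) ->
  exists (p : bits n.+1) v, p b (+) literal (false, omap (lift b) a) p = c /\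
    forall x : bits n.+1, x b (+) literal (false, omap (lift b) a) x = c -> f x = v (+) (x == p).
Proof.
case/spikeP => p [v h]; pose e := c (+) literal (false, a) p.
have dropK : [ffun i => insert_bit b e p (lift b i)] = p.
  by apply/ffunP => i; rewrite !ffunE liftK.
exists (insert_bit b e p), v; split.
  by rewrite -literal_drop dropK ffunE unlift_none addbK.
move=> x hx; rewrite -{1}(insert_bitK x b).
have -> : x b = c (+) literal (false, a) [ffun i => x (lift b i)].
  by rewrite literal_drop -hx addbK.
rewrite -/(xor_restr f b a c _) h; congr (_ (+) _); apply/eqP/eqP => [xp|->//].
rewrite -(insert_bitK x b) xp; congr insert_bit.
by rewrite /e -xp literal_drop -hx addbK.
Qed.

(** Serves to compare two halves: among four common points, one avoids both exceptional points [u]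
    and [w]. *)
Lemma pigeonhole_bool2 (T : eqType) (pt : bool -> bool -> T) u w :
    (forall a b a' b', pt a b = pt a' b' -> a = a' /\ b = b') ->
    (forall a b, (pt a b == u) || (pt a b == w)) -> False.
Proof.
move=> inj h.
have := h true true; have := h true false; have := h false true.
by do 3![case/orP => /eqP ?]; subst;
  match goal with e : pt _ _ = pt _ _ |- _ => by case: (inj _ _ _ _ e) end.
Qed.

Lemma ex_ord_notin n (s : seq 'I_n) : (size s < n)%N -> exists k, k \notin s.
Proof.
move=> sn; apply/existsP; apply: contraLR sn => /existsPn h.
rewrite -leqNgt -[X in (X <= _)%N]card_ord cardE; apply: uniq_leq_size (enum_uniq _) _.
by move=> k _; have := h k; rewrite negbK.
Qed.

(* If no single-bit query works, then on each half {x_i = c_i} f takes the value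
   v except at one point p_i.  If p_i = p_j for some i <> j, query x_i xor x_j;
   otherwise p is injective and any such query works. *)
Lemma ex_split n (f : boolfun n.+1) : (3 <= n)%N -> ~~ spike f ->
  exists b a, forall c, ~~ spike (xor_restr f b a c).
Proof.
move=> n3 /negP nsp; apply: boolp.contrapT => nex.
have bad b a : exists c, spike (xor_restr f b a c).
  apply: boolp.contrapT => h; apply: nex; exists b, a => c; apply/negP => hc.
  by apply: h; exists c.
(* This uses that there are at least four bits. *)
have two_more (i j : 'I_n.+1) : exists k l,
    [/\ k != i, k != j & [/\ l != i, l != j & l != k]].
  have [k] := @ex_ord_notin n.+1 [:: i; j] (ltnW n3).
  have [l] := @ex_ord_notin n.+1 [:: k; i; j] n3.
  rewrite !inE !negb_or => /and3P [? ? ?] /andP [? ?]; by exists k, l.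
have /fin_all_exists [s hs] (i : 'I_n.+1) : exists s : bits n.+1 * bool,
    forall x : bits n.+1, x i = s.1 i -> f x = s.2 (+) (x == s.1).
  have [c /spike_xor_restr [p [v [pc h]]]] := bad i None.
  exists (p, v) => x xp; apply: h; rewrite -pc /= xp //.
pose p i := (s i).1; pose v := (s ord0).2.
have vE i : (s i).2 = v.
  have [->//|i0] := eqVneq i ord0; apply: boolp.contrapT => nv.
  have [k [l [ki k0 [li l0 lk]]]] := two_more i ord0.
  (* Four points common to the halves of [i] and [0], varying in bits [k] and [l]: if the two
     generic values differed, each point would be exceptional for one of the halves. *)
  pose pt a b : bits n.+1 := [ffun m => if m == i then p i i else
    if m == ord0 then p ord0 ord0 else if m == k then a else b].
  apply: (@pigeonhole_bool2 _ pt (p i) (p ord0)) => [a b a' b' e|a b].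
    have /ffunP/(_ k) := e; have /ffunP/(_ l) := e.
    rewrite !ffunE (negbTE ki) (negbTE k0) (negbTE li) (negbTE l0) (negbTE lk) eqxx.
    by [].
  have e1 := hs i (pt a b); have e2 := hs ord0 (pt a b).
  move: e1 e2 nv; rewrite !ffunE !eqxx (eq_sym ord0) (negbTE i0) => -> //.
  rewrite -/v -!/(p _) => /(_ erefl).
  by case: (s i).2 v (_ == _) (_ == _) => [] [] [] [].
have fp i (x : bits n.+1) : x i = p i i -> (f x != v) = (x == p i).
  by move=> /hs ->; rewrite vE -/(p i); case: (x == p i); case: (v).
have fpp i : f (p i) != v by rewrite (fp i) // eqxx.
have half_v i j c w (q : bits n.+1) : i != j ->
    (forall x : bits n.+1, x i (+) x j = c -> f x = w (+) (x == q)) ->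
  forall x : bits n.+1, x i (+) x j = c -> (f x != v) = (x == q).
  move=> ij h; suff -> : v = w by move=> x /h ->; case: (w); case: (x == q).
  apply: boolp.contrapT => vw.
  have [k [l [ki kj [li lj lk]]]] := two_more i j.
  (* The same comparison, between the xor half and the half of a third bit [k]. *)
  pose pt a b : bits n.+1 := [ffun m => if m == i then c (+) a else
    if m == j then a else if m == k then p k k else b].
  apply: (@pigeonhole_bool2 _ pt (p k) q) => [a b a' b' e|a b].
    have /ffunP/(_ j) := e; have /ffunP/(_ l) := e.
    rewrite !ffunE (eq_sym j) (negbTE ij) (negbTE li) (negbTE lj) (negbTE lk) eqxx.
    by [].
  rewrite -(fp k); last by rewrite ffunE (negbTE ki) (negbTE kj) eqxx.
  rewrite (h (pt a b)); last first.
    by rewrite !ffunE !eqxx (eq_sym j) (negbTE ij) addbK.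
  by move: vw; case: (v) (w) (pt a b == q) => [] [] [].
have [i [j [ij hij]]] : exists i j, i != j /\ (p i = p j \/ injective p).
  have [pinj|/injectivePn [i [j ij e]]] := boolP (injectiveb p).
    have [k [_ [k0 _ _]]] := two_more ord0 ord0.
    by exists k, ord0; split=> //; right; apply/injectiveP.
  by exists i, j; split=> //; left.
have [a ja] : exists a, j = lift i a.
  by case: (unliftP i j) ij => [a ->|->]; [exists a | rewrite eqxx].
have [c /spike_xor_restr [q [w [qc /= h]]]] := bad i (Some a).
rewrite /literal /= -ja in qc h.
have hv := half_v i j c w q ij h.
have fq : f q != v by rewrite hv ?eqxx.
have [cE|cE] := eqVneq c (p i i (+) p j j); last first.
  (* Here [q] agrees with [p i] at [i] or with [p j] at [j], so it lies in one of these two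
     halves. *)
  have qij : q = p i \/ q = p j.
    have [e|e] := eqVneq (q i) (p i i).
      by left; apply/eqP; rewrite -(fp i).
    right; apply/eqP; rewrite -(fp j) //.
    by move: cE e; rewrite -qc; case: (q i) (q j) (p i i) (p j j) => [] [] [] [].
  case: hij => [e|pinj].
    by move: cE; rewrite -qc; case: qij => ->; rewrite e eqxx.
  (* By injectivity [p i] lies outside the half of [j], and conversely; this puts both in the xor
     half, where [q] is the only exception. *)
  have pij : p i j != p j j.
    apply/eqP => e; have := fpp i; rewrite (fp j) // => /eqP /pinj ep.
    by rewrite ep eqxx in ij.
  have pji : p j i != p i i.
    apply/eqP => e; have := fpp j; rewrite (fp i) // => /eqP /pinj ep.
    by rewrite ep eqxx in ij.
  have e1 : p i = q.
    apply/eqP; rewrite -hv ?fpp //.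
    by move: cE pij; case: (c) (p i i) (p i j) (p j j) => [] [] [] [].
  have e2 : p j = q.
    apply/eqP; rewrite -hv ?fpp //.
    by move: cE pji; case: (c) (p i i) (p j i) (p j j) => [] [] [] [].
  by move/eqP: ij; apply; apply: pinj; rewrite e1 e2.
case: hij => [e|pinj].
  (* The halves of [i], of [j] and of the xor now cover the cube, and all have the same exceptional
     point. *)
  apply: nsp; apply/spikeP; exists q, v => x.
  have [fx|fx] := boolP (f x != v); last first.
    have -> : (x == q) = false.
      by apply/negbTE; apply: contra fx => /eqP ->.
    by rewrite addbF; apply/eqP; rewrite -[_ == _]negbK.
  have -> : x == q.
    rewrite -hv // cE.
    have [xi|xi] := eqVneq (x i) (p i i).
      have := fx; rewrite (fp i) // => /eqP ->; by rewrite {2}e.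
    have [xj|xj] := eqVneq (x j) (p j j).
      by move: xi; have := fx; rewrite (fp j) // -e => /eqP ->; rewrite eqxx.
    by move: xi xj; case: (x i) (p i i) (x j) (p j j) => [] [] [] [].
  by move: fx; case: (f x) (v) => [] [].
(* By injectivity [p k] avoids the halves of [i] and [j], hence lies in the xor half; two such [k]
   contradict injectivity. *)
have pq k : k != i -> k != j -> p k = q.
  move=> ki kj; apply/eqP; rewrite -hv ?fpp // cE.
  have : p k i != p i i.
    apply: contraNN ki => /eqP e; have := fpp k; rewrite (fp i) // => /eqP /pinj ->.
    exact: eqxx.
  have : p k j != p j j.
    apply: contraNN kj => /eqP e; have := fpp k; rewrite (fp j) // => /eqP /pinj ->.
    exact: eqxx.
  by case: (p k i) (p k j) (p i i) (p j j) => [] [] [] [].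
have [k [l [ki kj [li lj lk]]]] := two_more i j.
by move/eqP: lk; apply; apply: pinj; rewrite !pq.
Qed.

(** * Functions of three bits *)

Notation triple := (bool * bool * bool)%type.

Definition triple_of (x : bits 3) : triple :=
  (x (inord 0), x (inord 1), x (inord 2)).

Definition of_triple (y : triple) : bits 3 :=
  [ffun i : 'I_3 => if val i is i'.+1 then if i' is 0 then y.1.2 else y.2 else y.1.1].

Lemma triple_ofK : cancel triple_of of_triple.
Proof.
move=> x; apply/ffunP => - [[|[|[|//]]]] i3; rewrite ffunE /=;
by congr (x _); apply: val_inj; rewrite /= inordK.
Qed.

Lemma of_tripleK : cancel of_triple triple_of.
Proof. by move=> [[a b] c]; rewrite /triple_of !ffunE /= !inordK. Qed.

Definition triples : seq triple :=
  [:: (false, false, false); (false, false, true); (false, true, false);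
      (false, true, true); (true, false, false); (true, false, true);
      (true, true, false); (true, true, true)].

(** Indices out of range read bit 0, in agreement with [inord]. *)
Definition opt_bit (q : option nat) (y : triple) : bool :=
  match q with
  | None => false | Some 1 => y.1.2 | Some 2 => y.2 | _ => y.1.1
  end%N.

(* [orb] is a function, hence strict under call by value: the branches below
   keep the searches lazy. *)
Fixpoint lazy_has T (P : T -> bool) s :=
  if s is x :: s' then if P x then true else lazy_has P s' else false.

Fixpoint lazy_all T (P : T -> bool) s :=
  if s is x :: s' then if P x then lazy_all P s' else false else true.

Definition queries1 : seq (option nat * option nat) :=
  [:: (None, None); (None, Some 0); (None, Some 1); (None, Some 2);
      (Some 0, Some 1); (Some 0, Some 2); (Some 1, Some 2)]%N.

Definition const_on (F D : pred triple) : bool :=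
  lazy_has (fun v => lazy_all (fun y => if D y then F y == v else true) triples)
    [:: true; false].

Definition one_query (F D : pred triple) : bool :=
  lazy_has (fun q => lazy_all (fun c =>
      const_on F (fun y => D y && (opt_bit q.1 y (+) opt_bit q.2 y == c)))
    [:: true; false]) queries1.

Definition flip_bit (q : bool * option nat) y := q.1 (+) opt_bit q.2 y.

Definition pairs4 : seq (nat * nat) :=
  [:: (0, 1); (0, 2); (0, 3); (1, 2); (1, 3); (2, 3)]%N.

(** The computable form of the hypotheses of [solves_four], with one query left. *)
Definition two_queries_four (F : pred triple) (s : seq (bool * option nat)) : bool :=
  let b i := flip_bit (nth (false, None) s i) in
  (if lazy_all (fun ij => one_query F (fun y => b ij.1 y != b ij.2 y)) pairs4
   then one_query F (fun y => b 0 y + (b 1 y + (b 2 y + b 3 y)) != 2) else false)%N.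

(** The first list encodes xor queries as in [solves_branch]; the second takes a constant and the
    three bits, possibly negated. The constant can stay 0, since negating all four literals changes
    no test. *)
Definition queries2 : seq (seq (bool * option nat)) :=
  [seq [:: (false, q.1); (false, q.1); (false, q.2); (false, q.2)] | q <- queries1] ++
  [seq [:: (false, None); (y.1.1, Some 0); (y.1.2, Some 1); (y.2, Some 2)] | y <- triples]%N.

Definition two_queries (F : pred triple) : bool :=
  lazy_has (two_queries_four F) queries2.

Definition spike3 (F : pred triple) : bool :=
  lazy_has (fun y => lazy_has (fun v =>
     lazy_all (fun z => F z == v (+) (z == y)) triples) [:: true; false]) triples.

Definition table (a b c d e f g h : bool) : pred triple := fun y =>
  let: (u, v, w) := y in
  if u then if v then if w then h else g else if w then f else e
  else if v then if w then d else c else if w then b else a.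

Definition forall_bool (P : bool -> bool) := if P true then P false else false.

Lemma forall_boolP (P : bool -> bool) : forall_bool P -> forall b, P b.
Proof. by rewrite /forall_bool; case: ifP => // ? ? []. Qed.

Lemma two_queries_or_spike_table :
  forall_bool (fun a => forall_bool (fun b => forall_bool (fun c =>
  forall_bool (fun d => forall_bool (fun e => forall_bool (fun f =>
  forall_bool (fun g => forall_bool (fun h =>
    let F := table a b c d e f g h in
    if spike3 F then true else two_queries F)))))))).
Proof. by vm_compute. Qed.

Lemma lazy_hasE T (P : T -> bool) s : lazy_has P s = has P s.
Proof. by elim: s => //= x s ->; case: (P x). Qed.

Lemma lazy_allE T (P : T -> bool) s : lazy_all P s = all P s.
Proof. by elim: s => //= x s ->; case: (P x). Qed.

Lemma mem_triples y : y \in triples.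
Proof. by case: y => [[[] []] []]. Qed.

Lemma mem_bools (b : bool) : b \in [:: true; false].
Proof. by case: b. Qed.

Lemma tableP (F : pred triple) : exists a b c d e f g h, F =1 table a b c d e f g h.
Proof.
exists (F (false, false, false)), (F (false, false, true)), (F (false, true, false)),
  (F (false, true, true)), (F (true, false, false)), (F (true, false, true)),
  (F (true, true, false)), (F (true, true, true)).
by case=> [[[] []] []].
Qed.

Lemma literal_opt_bit b q x :
  literal (b, omap (inord : nat -> 'I_3) q) x = b (+) opt_bit q (triple_of x).
Proof.
rewrite /literal; congr (_ (+) _); case: q => [[|[|[|i]]]|] //=.
have -> : inord i.+3 = ord0 :> 'I_3 by rewrite /inord /insubd insubN.
by congr (x _); apply: val_inj; rewrite /= inordK.
Qed.

Section ThreeBits.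
Variables (R : realType) (f : boolfun 3) (F : pred triple).
Hypothesis fF : forall x, f x = F (triple_of x).

Lemma const_on_solves D t : const_on F D -> solves_on R f t (fun x => D (triple_of x)).
Proof.
rewrite /const_on lazy_hasE => /hasP [v _]; rewrite lazy_allE => /allP h.
apply: (@solves_const R 3 f t _ v) => x; rewrite /in_mem /= fF => Dx.
by have := h _ (mem_triples (triple_of x)); rewrite Dx => /eqP.
Qed.

Lemma one_query_solves (D : pred triple) :
  one_query F D -> solves_on R f 1 (fun x => D (triple_of x)).
Proof.
rewrite /one_query lazy_hasE => /hasP [q _]; rewrite lazy_allE => /allP h.
apply: (solves_branch (a := omap inord q.1) (b := omap inord q.2)) => c.
have := const_on_solves 0 (h c (mem_bools c)); apply: solves_on_sub => x.
by rewrite /in_mem /= !literal_opt_bit.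
Qed.

Lemma two_queries_solvable : two_queries F -> solvable R f 2.
Proof.
rewrite /two_queries lazy_hasE => /hasP [s _]; rewrite /two_queries_four.
case: ifP => //; rewrite lazy_allE => /allP h1 h2.
pose q (i : 'I_4) := let r := nth (false, None) s i in (r.1, omap inord r.2 : option 'I_3).
apply: (@solves_four R 3 f 1 predT q) => [a b ab|].
  have abP : (a : nat, b : nat) \in pairs4.
    by case: a b ab => [[|[|[|[|//]]]] ?] [[|[|[|[|//]]]] ?].
  have := one_query_solves (h1 _ abP); apply: solves_on_sub => x.
  by rewrite /in_mem /= !literal_opt_bit.
have := one_query_solves h2; apply: solves_on_sub => x.
by rewrite /in_mem /= !big_ord_recl big_ord0 addn0 !literal_opt_bit.
Qed.

Lemma spike3_spike : spike3 F -> spike f.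
Proof.
rewrite /spike3 lazy_hasE => /hasP [y _]; rewrite lazy_hasE => /hasP [v _].
rewrite lazy_allE => /allP h; apply/spikeP; exists (of_triple y), v => x.
rewrite fF (eqP (h _ (mem_triples (triple_of x)))); congr (_ (+) _).
by rewrite -(can_eq of_tripleK) triple_ofK.
Qed.

End ThreeBits.

Lemma solvable_three (R : realType) (f : boolfun 3) : ~~ spike f -> solvable R f 2.
Proof.
have [a [b [c [d [e [g [h [i E]]]]]]]] := tableP (fun y => f (of_triple y)).
have fF x : f x = table a b c d e g h i (triple_of x) by rewrite -E triple_ofK.
have := two_queries_or_spike_table.
move=> /forall_boolP/(_ a)/forall_boolP/(_ b)/forall_boolP/(_ c)/forall_boolP/(_ d).
move=> /forall_boolP/(_ e)/forall_boolP/(_ g)/forall_boolP/(_ h)/forall_boolP/(_ i).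
cbv zeta; case: ifP => [/(spike3_spike fF) -> //|_ h2 _].
exact: two_queries_solvable fF h2.
Qed.

(** * Induction from three bits, and the equivalence *)

Lemma solvable_nonspike (R : realType) n (f : boolfun n.+1) :
  (2 <= n)%N -> ~~ spike f -> solvable R f n.
Proof.
(* Equality is the base case of three bits; otherwise there are at least four, as [ex_split]
   requires. *)
elim: n f => // n IH f; rewrite leq_eqVlt => /predU1P [n2|n2 nf].
  by case: n n2 {IH} f => [|[|]] // _ f; apply: solvable_three.
have [b [a h]] := ex_split n2 nf.
by apply: solvable_xor_restr => c; apply: IH.
Qed.

Local Close Scope ring_scope.

Theorem theorem7 (R : realType) (n : nat) (hn : 3 < n) (f : boolfun n) :
  is_QE R f n <-> isomorphic f (@AND n).
Proof.
rewrite isomorphic_AND; split=> [[_ fmin]|fs]; last first.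
  split=> [|t [A hA]]; first exact/solvable_exact_queries/solvable_all.
  exact: spike_lower_bound fs hA.
apply: contraT => nf; case: n hn f fmin nf => // n hn f fmin nf.
by have := fmin n (solvable_exact_queries (solvable_nonspike R (ltnW hn) nf)); rewrite ltnn.
Qed.
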